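(* Suppose that $1<d\le n-2$ and $n$ is sufficiently large. (1) When $d=o(n)$, $A(n,d)\ge\left(\frac{d}{\sqrt e\,n}\right)^{2d}n^{n-d}$. In this range, for $d\ge2\sqrt n$ we have $A(n,d)\ge\left(\frac4e\right)^d n^{n-2d}$; and for $d=n^{1-o(1)}$ we have $A(n,d)\ge n^{n-d-o(d)}$. (2) When $d=\delta n$ with $\delta\in(0,1)$, $A(n,d)\ge2.5\,(c_\delta n)^{n-d+1/2}$, where $$c_\delta=(1-\delta)\,\delta^{\frac{\delta}{1-\delta}}\max\left\{\delta^{\frac{\delta}{1-\delta}},\tfrac12\right\}\in(0,1)$$ is decreasing in $\delta$, and $c_\delta\to1$ as $\delta\to0$. (3) When $n-d=o(n)$, $A(n,d)\ge\left(\frac{n-d}{2e}\right)^{n-d}$. Moreover, given any fixed integer $k\ge1$, we have $A(n,d)=\Omega(n^k)$ when $d=n-\frac{(k+1)\ln n}{\ln\ln n}$ (rounded to an integer).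
   Context: $[n]=\{1,\dots,n\}$, and $\mathcal{T}(n)$ is the set of all spanning trees of the complete graph on vertex set $[n]$. The tree-distance of $T_1=([n],E_1)$ and $T_2=([n],E_2)$ in $\mathcal{T}(n)$ is $d(T_1,T_2)=n-1-|E_1\cap E_2|$. $A(n,d)$ is the maximum size of a set $\mathcal{C}\subseteq\mathcal{T}(n)$ whose distinct elements have pairwise tree-distance at least $d$. In asymptotic statements $d=d(n)$ is an integer that may depend on $n$, $\delta$ is a constant, and $n\to\infty$. *)

(* Defs.v *)
From mathcomp Require Import all_boot all_order all_algebra.
From mathcomp Require Import all_classical all_reals all_analysis.
Set Implicit Arguments.
Unset Strict Implicit.
Unset Printing Implicit Defensive.
Import Order.TTheory GRing.Theory Num.Theory numFieldNormedType.Exports.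

(* The vertex set [n] = {1, ..., n} is represented by 'I_n, and a graph on it
   by its edge set, a set of unordered pairs of vertices. *)

Definition adj (n : nat) (E : {set {set 'I_n}}) : rel 'I_n :=
  fun x y => (x != y) && ([set x; y]%SET \in E).

Definition is_graph (n : nat) (E : {set {set 'I_n}}) : Prop :=
  forall e : {set 'I_n}, e \in E -> #|e| = 2.

Definition is_connected (n : nat) (E : {set {set 'I_n}}) : Prop :=
  forall x y : 'I_n, fingraph.connect (adj E) x y.

(* Cycles have at least 3 vertices: an edge traversed back and forth is a
   ucycle of size 2. *)
Definition is_acyclic (n : nat) (E : {set {set 'I_n}}) : Prop :=
  ~ exists c : seq 'I_n, (2 < size c)%N /\ ucycle (adj E) c.

Definition spanning_trees (n : nat) : {set {set {set 'I_n}}} :=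
  [set E : {set {set 'I_n}} |
    `[< [/\ is_graph E, is_connected E & is_acyclic E] >]]%SET.

Definition tree_dist (n : nat) (T1 T2 : {set {set 'I_n}}) : nat :=
  (n - 1 - #|(T1 :&: T2)%SET|)%N.

Definition tree_code (n d : nat) (C : {set {set {set 'I_n}}}) : bool :=
  (C \subset spanning_trees n) &&
  [forall T1 in C, forall T2 in C, (T1 != T2) ==> (d <= tree_dist T1 T2)%N].

Definition A (n d : nat) : nat :=
  (\max_(C : {set {set {set 'I_n}}} | tree_code d C) #|C|)%N.

Local Open Scope classical_set_scope.
Local Open Scope ring_scope.

Definition c_ (R : realType) (delta : R) : R :=
  (1 - delta) * (delta `^ (delta / (1 - delta)))
  * Num.max (delta `^ (delta / (1 - delta))) (1 / 2).

Definition admissible (d : nat -> nat) : Prop :=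
  \forall n \near \oo, (1 < d n <= n - 2)%N.

(* Main.v *)
Require Import Defs.
From mathcomp Require Import all_boot all_order all_algebra.
From mathcomp Require Import ring lra zify.
Import Order.TTheory GRing.Theory Num.Theory.
Set Implicit Arguments.
Unset Strict Implicit.

(** All the lower bounds come from one covering argument of Gilbert-Varshamov
    type. In a largest code every spanning tree shares at least n - d edges with
    some codeword ([A_cover]), so it contains one of the 'C(n-1, n-d) subforests
    with n - d edges, equivalently with d components, of that codeword. A forest
    with d components of sizes s_1, ..., s_d lies in exactly n^(d-2) s_1 ... s_d
    spanning trees ([card_trees_containing]), and there are n^(n-2) trees.
    Therefore ([gilbert_varshamov])

      n^(n-d) <= A(n,d) * 'C(n-1, n-d) * max (s_1 ... s_d),

    where the product of the sizes is at most (n/d)^d, by the inequality of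
    arithmetic and geometric means, and at most 2^(n-d).

    The rest is calculus. For small d, the first bound and
    'C(n-1, n-d) <= (e n/d)^d give [A_ge_small_d], from which the estimates for
    d = o(n) follow. For d close to n, the second bound and
    'C(n-1, n-d) <= (e n/(n-d))^(n-d) give [A_ge_large_d]; with
    m = n - d ~ (k + 1) ln n / ln ln n, the quantity (m/(2e))^m is
    n^(k + 1 - o(1)), hence the growth n^k. For d proportional to n, the better
    of the two bounds is the maximum in the definition of c, and the factor
    5/2 * sqrt n requires a Stirling estimate of the binomial coefficient
    ([ln_bin_le]). Write x = d/n: then the bound holds with c(x)
    ([A_ge_linear_d]), hence with c(delta) for x <= delta < 1, because c is
    decreasing. *)

(** * Connectivity and components *)

Lemma adj_sym (n : nat) (E : {set {set 'I_n}}) : symmetric (adj E).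
Proof. by move=> x y; rewrite /adj eq_sym setUC. Qed.

Lemma connect_adj_sym (n : nat) (E : {set {set 'I_n}}) :
  connect_sym (adj E).
Proof. exact/sym_connect_sym/adj_sym. Qed.

Lemma connect_adj_subset (n : nat) (E E' : {set {set 'I_n}}) (x y : 'I_n) :
  E \subset E' -> fingraph.connect (adj E) x y ->
  fingraph.connect (adj E') x y.
Proof.
move=> sEE'; apply: connect_sub => a b /andP[ab Eab].
by apply: connect1; rewrite /adj ab (subsetP sEE').
Qed.

Lemma pair_setP (T : finType) (a b x y : T) :
  [set a; b] = [set x; y] -> (a = x /\ b = y) \/ (a = y /\ b = x).
Proof.
move=> eab.
have := set21 a b; have := set22 a b; have := set21 x y; have := set22 x y.
rewrite eab -{1 2}eab !inE.
by do 4![case/orP=> /eqP ?]; subst; auto.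
Qed.

Lemma adj_setU1 (n : nat) (E : {set {set 'I_n}}) (x y a b : 'I_n) :
  adj ([set x; y] |: E) a b ->
  [\/ adj E a b, a = x /\ b = y | a = y /\ b = x].
Proof.
case/andP=> ab; rewrite !inE => /orP[/eqP/pair_setP[]|Eab].
- by constructor 2.
- by constructor 3.
- by constructor 1; rewrite /adj ab.
Qed.

(** A path in the enlarged graph either avoids the new edge, or can be cut at
    it so that it crosses it once, in one of the two directions. *)
Lemma connect_setU1 (n : nat) (E : {set {set 'I_n}}) (x y a b : 'I_n) :
  x != y ->
  let conn := fingraph.connect (adj E) in
  fingraph.connect (adj ([set x; y] |: E)) a b =
    [|| conn a b, conn a x && conn y b | conn a y && conn x b].
Proof.
move=> xy conn.
have connS u v : conn u v -> fingraph.connect (adj ([set x; y] |: E)) u v.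
  exact/connect_adj_subset/subsetUr.
have cxy : fingraph.connect (adj ([set x; y] |: E)) x y.
  by apply: connect1; rewrite /adj xy !inE eqxx.
apply/idP/idP; last first.
  case/or3P=> [/connS //|/andP[/connS ax /connS yb]|/andP[/connS ay /connS xb]].
    exact: connect_trans ax (connect_trans cxy yb).
  rewrite connect_adj_sym in cxy.
  exact: connect_trans ay (connect_trans cxy xb).
case/connectP=> p; elim: p a => [|c p IH] a /=.
  by move=> _ ->; rewrite /conn connect0.
case/andP=> /adj_setU1 ac pth /(IH _ pth) {IH pth}.
case: ac => [/connect1 ac|[-> ->]|[-> ->]].
- case/or3P=> [cb|/andP[cx yb]|/andP[cy xb]].
  + by rewrite [conn a b](connect_trans ac cb).
  + by rewrite [conn a x](connect_trans ac cx) yb /= orbT.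
  + by rewrite [conn a y](connect_trans ac cy) xb /= !orbT.
- case/or3P=> [yb|/andP[_ yb]|/andP[_ xb]].
  + by rewrite yb [conn x x]connect0 orbT.
  + by rewrite yb [conn x x]connect0 orbT.
  + by rewrite xb.
- case/or3P=> [xb|/andP[_ yb]|/andP[_ xb]].
  + by rewrite xb [conn y y]connect0 !orbT.
  + by rewrite yb.
  + by rewrite xb [conn y y]connect0 !orbT.
Qed.

Definition component (n : nat) (E : {set {set 'I_n}}) (x : 'I_n) : {set 'I_n} :=
  [set y | fingraph.connect (adj E) x y].

Definition components (n : nat) (E : {set {set 'I_n}}) : {set {set 'I_n}} :=
  [set component E x | x : 'I_n].

Lemma mem_component (n : nat) (E : {set {set 'I_n}}) (x : 'I_n) :
  x \in component E x.
Proof. by rewrite inE connect0. Qed.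

Lemma mem_components (n : nat) (E : {set {set 'I_n}}) (x : 'I_n) :
  component E x \in components E.
Proof. exact: imset_f. Qed.

Lemma eq_component (n : nat) (E : {set {set 'I_n}}) (x y : 'I_n) :
  (component E x == component E y) = fingraph.connect (adj E) x y.
Proof.
apply/eqP/idP => [exy|cxy].
  by have := mem_component E y; rewrite -exy inE.
by apply/setP=> z; rewrite !inE (same_connect (@connect_adj_sym n E) cxy).
Qed.

Lemma components_partition (n : nat) (E : {set {set 'I_n}}) :
  partition (components E) [set: 'I_n].
Proof.
have -> : components E =
    equivalence_partition (fingraph.connect (adj E)) [set: 'I_n].
  have ce x :
      [set y in [set: 'I_n] | fingraph.connect (adj E) x y] = component E x.
    by apply/setP=> y; rewrite !inE.
  by apply/setP=> B; apply/imsetP/imsetP=> -[x _ ->]; exists x; rewrite ?ce.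
apply: equivalence_partitionP => x y z _ _ _.
split; first exact: connect0.
by move=> cxy; rewrite (same_connect (@connect_adj_sym n E) cxy).
Qed.

Lemma disjoint_component (n : nat) (E : {set {set 'I_n}}) (x y : 'I_n) :
  ~~ fingraph.connect (adj E) x y ->
  component E x :&: component E y = set0.
Proof.
move=> ncxy; apply/setP=> z; rewrite !inE; apply/negP=> /andP[xz yz].
by case/negP: ncxy; apply: connect_trans xz _; rewrite connect_adj_sym.
Qed.

(** An edge between two components merges them and leaves the others alone. *)
Lemma components_setU1 (n : nat) (E : {set {set 'I_n}}) (x y : 'I_n) :
  ~~ fingraph.connect (adj E) x y ->
  components ([set x; y] |: E) =
    (component E x :|: component E y)
      |: (components E :\ component E x :\ component E y).
Proof.
move=> ncxy.
have xy : x != y by apply: contraNneq ncxy => ->; exact: connect0.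
have csym := @connect_adj_sym n E.
have cE a : component ([set x; y] |: E) a =
    if (component E a == component E x) || (component E a == component E y)
    then component E x :|: component E y else component E a.
  rewrite !eq_component; apply/setP=> b; rewrite inE connect_setU1 //=.
  have [ax|ax] /= := boolP (fingraph.connect (adj E) a x).
    by rewrite !inE !(same_connect csym ax) (negbTE ncxy) orbF.
  have [ay|ay] /= := boolP (fingraph.connect (adj E) a y).
    by rewrite !inE !(same_connect csym ay) orbC.
  by rewrite inE orbF.
apply/setP=> B; apply/imsetP/idP => [[a _ ->]|].
  rewrite cE !inE; case: ifP => [_|/norP[-> ->]]; rewrite ?eqxx //=.
  by rewrite imset_f ?orbT.
rewrite !inE => /orP[/eqP->|/and3P[By Bx /imsetP[a _ eB]]].
  by exists x => //; rewrite cE eqxx.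
by exists a => //; rewrite cE -eB (negbTE Bx) (negbTE By).
Qed.

Lemma component_union_notin (n : nat) (E : {set {set 'I_n}}) (x y : 'I_n) :
  ~~ fingraph.connect (adj E) x y ->
  component E x :|: component E y \notin
    components E :\ component E x :\ component E y.
Proof.
move=> ncxy; rewrite !inE; apply/negP=> /and3P[_ nUx /imsetP[z _ Uz]].
case/negP: nUx; rewrite Uz eq_component.
have : x \in component E z by rewrite -Uz inE mem_component.
by rewrite inE.
Qed.

Lemma card_components_setU1 (n : nat) (E : {set {set 'I_n}}) (x y : 'I_n) :
  ~~ fingraph.connect (adj E) x y ->
  #|components E| = #|components ([set x; y] |: E)|.+1.
Proof.
move=> ncxy; rewrite components_setU1 // cardsU1 component_union_notin //.
rewrite (cardsD1 (component E x)) mem_components.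
rewrite (cardsD1 (component E y) (_ :\ _)) in_setD1 mem_components andbT.
by rewrite eq_sym eq_component ncxy.
Qed.

(** Merging blocks of sizes s and t multiplies the product of the block sizes by
    (s + t) / (s t) = 1 / s + 1 / t; this is the multiplicative form that makes
    the induction of [card_trees_containing] work. *)
Lemma prod_components_setU1 (n : nat) (E : {set {set 'I_n}}) (x y : 'I_n) :
  ~~ fingraph.connect (adj E) x y ->
  (#|component E x| * #|component E y|
     * \prod_(B in components ([set x; y] |: E)) #|B|
   = (#|component E x| + #|component E y|)
     * \prod_(B in components E) #|B|)%N.
Proof.
move=> ncxy; rewrite components_setU1 //.
rewrite big_setU1 ?component_union_notin //=.
rewrite [X in (_ = _ * X)%N](big_setD1 (component E x)) ?mem_components //=.
rewrite [X in (_ = _ * (_ * X))%N](big_setD1 (component E y)) /=; last first.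
  by rewrite in_setD1 mem_components andbT eq_sym eq_component.
rewrite cardsU disjoint_component // cards0 subn0.
by rewrite mulnCA -mulnA.
Qed.

Lemma card_components_set0 (n : nat) : 
  #|components (set0 : {set {set 'I_n}})| = n.
Proof.
rewrite card_imset ?card_ord // => x y /eqP.
rewrite eq_component => /connectP[[|z p] //=].
by rewrite /adj inE andbF.
Qed.

Lemma sum_card_components (n : nat) (E : {set {set 'I_n}}) :
  (\sum_(B in components E) #|B|)%N = n.
Proof.
by rewrite -(card_partition (components_partition E)) cardsT card_ord.
Qed.

(** * Forests and spanning trees *)

(** A forest is described by the property that each edge is a bridge, rather
    than by the absence of cycles: this form is immediately inherited by
    subgraphs and is tested on one edge at a time. *)
Definition is_forest (n : nat) (E : {set {set 'I_n}}) : Prop :=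
  is_graph E /\
  forall x y, adj E x y -> ~~ fingraph.connect (adj (E :\ [set x; y])) x y.

(** A cycle through an edge gives a detour around it, and conversely a detour
    around an edge, closed by the edge, is a cycle. *)
Lemma forest_acyclic (n : nat) (E : {set {set 'I_n}}) :
  is_graph E -> is_forest E <-> is_acyclic E.
Proof.
move=> gE; split=> [[_ bridge] [c [c3 /andP[cyc uc]]]|acyc].
  case: c c3 cyc uc => [|x [|y c]] //= c3 /andP[xy pyx] /andP[xyc yc].
  case/negP: (bridge _ _ xy).
  (* The rest of the cycle still joins y to x. *)
  rewrite connect_adj_sym; apply/connectP; exists (rcons c x) => //; last first.
    by rewrite last_rcons.
  have {}pyx : path (adj E) y (rcons c x) by [].
  have avoid s z : y \notin z :: s -> path (adj E) z s ->
      path (adj (E :\ [set x; y])) z s.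
    rewrite -has_pred1 -all_predC; apply: sub_in_path.
    move=> u v uy vy /andP[uv Euv].
    rewrite /adj uv !inE Euv andbT /=; apply/eqP=> /pair_setP[] [? ?]; subst.
      by move: vy; rewrite inE /= eqxx.
    by move: uy; rewrite inE /= eqxx.
  case: c c3 xyc yc pyx => [|z c] //= _ xyc yc /andP[/andP[yz Eyz] pzx].
  rewrite avoid // ?andbT.
    rewrite /adj yz !inE Eyz andbT /=; apply/eqP=> /pair_setP[] [e1 e2].
      by move: xyc; rewrite e1 inE eqxx.
    by move: xyc; rewrite e2 !inE eqxx orbT.
  move: yc; rewrite inE => /andP[/norP[yz' yc'] _].
  rewrite inE mem_rcons inE !negb_or yz' yc' andbT /=.
  by move: xyc; rewrite inE => /norP[]; rewrite eq_sym.
split=> // x y xy; apply/negP => /connectP[p].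
case/shortenP => {}p pxp up _ ey.
have {}pxp' : path (adj E) x p.
  apply: sub_path pxp => u v /andP[uv]; rewrite inE => /andP[_ Euv].
  by rewrite /adj uv.
apply: acyc; exists (x :: p); split; last first.
  by rewrite /ucycle up /= rcons_path pxp' -ey adj_sym xy.
move: xy pxp ey; case: (p) => [|z [|w q]] //= /andP[xy Exy].
  by move=> _ eyx; rewrite eyx eqxx in xy.
(* A path of length one would be the deleted edge itself. *)
move=> /andP[/andP[_]]; rewrite !inE => /andP[nxz _] _ yz.
by rewrite yz eqxx in nxz.
Qed.

Lemma forest_subset (n : nat) (E E' : {set {set 'I_n}}) :
  E \subset E' -> is_forest E' -> is_forest E.
Proof.
move=> sEE' [gE' bridge]; split=> [e eE|x y].
  exact: gE' (subsetP sEE' _ eE).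
case/andP=> xy Exy; apply: contra (bridge x y _).
  by apply: connect_adj_subset; apply: setSD.
by rewrite /adj xy (subsetP sEE').
Qed.

(** If the new edge restored the connection between the ends of a deleted edge
    ab, then following the detour and ab would already connect x to y. *)
Lemma forest_setU1 (n : nat) (E : {set {set 'I_n}}) (x y : 'I_n) :
  is_forest E -> ~~ fingraph.connect (adj E) x y ->
  is_forest ([set x; y] |: E).
Proof.
move=> [gE bridge] ncxy.
have xy : x != y by apply: contraNneq ncxy => ->; exact: connect0.
split=> [e|a b].
  by rewrite !inE => /orP[/eqP->|/gE//]; rewrite cards2 xy.
case/andP=> ab; rewrite in_setU1.
have [eab _|nab /= Eab] := eqVneq [set a; b] [set x; y].
  rewrite eab setU1K; last first.
    by apply: contra ncxy => Exy; apply: connect1; rewrite /adj xy.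
  by case: (pair_setP eab) => -[-> ->] //; rewrite connect_adj_sym.
have sDE : E :\ [set a; b] \subset E by exact: subsetDl.
have ncab : ~~ fingraph.connect (adj (E :\ [set a; b])) a b.
  by apply: bridge; rewrite /adj ab.
have cab : fingraph.connect (adj E) a b by apply: connect1; rewrite /adj ab.
have cba : fingraph.connect (adj E) b a by rewrite connect_adj_sym.
rewrite setDUl (setDidPl _); last by rewrite disjoints1 inE eq_sym.
rewrite connect_setU1 // (negbTE ncab) /=; apply/negP.
case/orP=> /andP[/(connect_adj_subset sDE) c1 /(connect_adj_subset sDE) c2].
  rewrite connect_adj_sym in c1; rewrite connect_adj_sym in c2.
  by case/negP: ncxy; apply: connect_trans c1 (connect_trans cab c2).
case/negP: ncxy; apply: connect_trans c2 (connect_trans cba c1).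
Qed.

Lemma forest_notin_connect (n : nat) (E E' : {set {set 'I_n}}) (x y : 'I_n) :
  is_forest E' -> E \subset E' -> adj E' x y -> [set x; y] \notin E ->
  ~~ fingraph.connect (adj E) x y.
Proof.
move=> [_ bridge] sEE' E'xy nExy; apply: contra (bridge _ _ E'xy).
by apply: connect_adj_subset; rewrite subsetD1 sEE'.
Qed.

(** Each edge of a forest lowers the number of components by exactly one. *)
Lemma card_components_forest (n : nat) (E : {set {set 'I_n}}) :
  is_forest E -> (#|components E| + #|E|)%N = n.
Proof.
move: {2}#|E| (erefl #|E|) => m; elim: m E => [|m IH] E cE fE.
  move/eqP: cE; rewrite cards_eq0 => /eqP ->.
  by rewrite cards0 addn0 card_components_set0.
have /card_gt0P[e Ee] : (0 < #|E|)%N by rewrite cE.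
have [gE bridge] := fE.
have /eqP/cards2P[x [y [xy exy]]] := gE _ Ee.
have ncxy : ~~ fingraph.connect (adj (E :\ e)) x y.
  by rewrite exy; apply: bridge; rewrite /adj xy -exy.
have eE : E = [set x; y] |: (E :\ e) by rewrite -exy setD1K.
have fDE : is_forest (E :\ e) by apply: forest_subset fE; exact: subsetDl.
have cD : #|E :\ e| = m by move: cE; rewrite (cardsD1 e) Ee => -[].
have := IH _ cD fDE; rewrite (card_components_setU1 ncxy) -eE cE cD.
by rewrite addSnnS.
Qed.

Lemma connected_components1 (n : nat) (E : {set {set 'I_n}}) : (0 < n)%N ->
  is_connected E <-> #|components E| = 1%N.
Proof.
case: n E => // n E _; split=> [conn|/eqP/cards1P[B eB] x y].
  apply/eqP/cards1P; exists (component E ord0); apply/setP=> B; rewrite inE.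
  apply/imsetP/eqP => [[x _ ->]|->]; last by exists ord0.
  by apply/eqP; rewrite eq_component; exact: conn.
have := mem_components E x; have := mem_components E y.
by rewrite eB !inE -eq_component => /eqP-> /eqP->.
Qed.

Lemma spanning_treesP (n : nat) (E : {set {set 'I_n}}) : (0 < n)%N ->
  E \in spanning_trees n <-> is_forest E /\ #|components E| = 1%N.
Proof.
move=> n0; rewrite inE; split.
  move/boolp.asboolP=> [gE /(connected_components1 _ n0) cE aE].
  by split=> //; apply/(forest_acyclic gE).
move=> [fE /(connected_components1 _ n0) cE]; apply/boolp.asboolP; split=> //.
  by case: fE.
by apply/forest_acyclic => //; case: fE.
Qed.

(** * Counting the spanning trees that contain a forest *)

Local Open Scope ring_scope.


Definition trees_containing (n : nat) (F : {set {set 'I_n}}) :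
    {set {set {set 'I_n}}} :=
  [set T in spanning_trees n | F \subset T].

Lemma card_ordered_pairs (T : finType) (e : {set T}) : #|e| = 2%N ->
  #|[set p : T * T | (p.1 != p.2) && ([set p.1; p.2] == e)]| = 2%N.
Proof.
move/eqP/cards2P=> [a [b [ab ->]]].
rewrite (_ : [set p | _] = [set (a, b); (b, a)]); last first.
  apply/setP=> -[u v]; rewrite !inE /=; apply/andP/orP.
    by case=> uv /eqP/pair_setP[] [-> ->]; [left|right].
  by case=> /eqP[-> ->]; split; rewrite // 1?eq_sym // setUC.
by rewrite cards2 xpair_eqE (negbTE ab).
Qed.

(** The edges of T between distinct components of F are the edges of T outside
    F; the factor 2 counts both orientations of each. *)
Lemma tree_crossing_edges (n : nat) (F T : {set {set 'I_n}}) : (0 < n)%N ->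
  T \in trees_containing F ->
  #|[set p : 'I_n * 'I_n | ~~ fingraph.connect (adj F) p.1 p.2
                           & [set p.1; p.2] \in T]|
  = (2 * (#|components F|).-1)%N.
Proof.
move=> n0; rewrite inE => /andP[/(spanning_treesP _ n0)[fT cT] sFT].
have fF := forest_subset sFT fT.
have cTF : #|T :\: F| = (#|components F|).-1.
  rewrite cardsD (setIidPr sFT).
  have := card_components_forest fT; have := card_components_forest fF.
  have := subset_leq_card sFT.
  lia.
rewrite -cTF mulnC -sum1_card.
rewrite (partition_big (fun p : 'I_n * 'I_n => [set p.1; p.2])
  (mem (T :\: F))) /=.
  rewrite -sum_nat_const; apply: eq_bigr => e; rewrite inE => /andP[eF eT].
  rewrite -[RHS](card_ordered_pairs (proj1 fT e eT)) -sum1_card.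
  apply: eq_bigl => -[u v]; rewrite !inE /=.
  have [euv|_] := eqVneq [set u; v] e; last by rewrite !andbF.
  rewrite euv eT !andbT.
  have [<-|uv] := eqVneq u v; first by rewrite connect0.
  by apply: (forest_notin_connect fT sFT); rewrite ?/adj ?uv euv.
move=> -[u v]; rewrite !inE /= => /andP[ncuv ->]; rewrite andbT.
have uv : u != v by apply: contraNneq ncuv => ->; exact: connect0.
by apply: contra ncuv => uvF; apply: connect1; rewrite /adj uv.
Qed.

(** Double counting of the pairs formed by a tree T containing F and an oriented
    edge of T outside F. *)
Lemma sum_trees_setU1 (n : nat) (F : {set {set 'I_n}}) : (0 < n)%N ->
  (\sum_(p : 'I_n * 'I_n | ~~ fingraph.connect (adj F) p.1 p.2)
     #|trees_containing ([set p.1; p.2] |: F)|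
   = 2 * (#|components F|).-1 * #|trees_containing F|)%N.
Proof.
move=> n0.
under eq_bigr do rewrite -sum1_card.
rewrite (exchange_big_dep (mem (trees_containing F))) /=; last first.
  by move=> p T _; rewrite !inE subUset => /and3P[-> _ ->].
rewrite mulnC -sum_nat_const; apply: eq_bigr => T TF.
rewrite -(tree_crossing_edges n0 TF) -sum1_card; apply: eq_bigl => -[u v].
move: TF; rewrite !inE /= subUset sub1set => /andP[-> ->].
by rewrite andbT.
Qed.

(** Each component contributes |B| terms 1 / |B|. *)
Lemma sum_inv_card_component (n : nat) (E : {set {set 'I_n}}) :
  \sum_x #|component E x|%:R^-1 = #|components E|%:R :> rat.
Proof.
have := set_partition_big (op := +%R)
  (E := fun x => #|component E x|%:R^-1 : rat) _ (components_partition E).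
rewrite (eq_bigl predT) => [->|x]; last by rewrite inE.
rewrite -sum1_card natr_sum; apply: eq_bigr => B /imsetP[x _ ->].
rewrite (eq_bigr (fun _ => #|component E x|%:R^-1)).
  rewrite sumr_const -[LHS]mulr_natl divff // pnatr_eq0 -lt0n.
  by apply/card_gt0P; exists x; exact: mem_component.
by move=> y; rewrite inE -eq_component => /eqP->.
Qed.

(** By symmetry the sum is twice that of 1 / |component x|, in which x occurs
    n - |component x| times. *)
Lemma sum_inv_crossing_pairs (n : nat) (E : {set {set 'I_n}}) :
  \sum_(p : 'I_n * 'I_n | ~~ fingraph.connect (adj E) p.1 p.2)
     (#|component E p.1|%:R^-1 + #|component E p.2|%:R^-1)
  = 2 * n%:R * (#|components E|%:R - 1) :> rat.
Proof.
have half : \sum_(p : 'I_n * 'I_n | ~~ fingraph.connect (adj E) p.1 p.2)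
     #|component E p.1|%:R^-1 = n%:R * (#|components E|%:R - 1) :> rat.
  rewrite -(pair_big_dep predT (fun x y => ~~ fingraph.connect (adj E) x y)
     (fun x y => #|component E x|%:R^-1)) /=.
  rewrite mulrBr mulr1 -sum_inv_card_component mulr_sumr.
  rewrite -[X in _ - X%:R](card_ord n) -sum1_card natr_sum -sumrB.
  apply: eq_bigr => x _; rewrite sumr_const -[LHS]mulr_natl.
  have s0 : #|component E x|%:R != 0 :> rat.
    rewrite pnatr_eq0 -lt0n; apply/card_gt0P; exists x; exact: mem_component.
  rewrite -[X in _ - X](divff s0) -mulrBl; congr (_ / _).
  have <- : #|~: component E x| = #|(fun y => ~~ fingraph.connect (adj E) x y)|.
    by apply: eq_card => y; rewrite !inE.
  rewrite cardsCs setCK card_ord natrB //.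
  by rewrite -[X in (_ <= X)%N](card_ord n) max_card.
rewrite big_split /= half.
rewrite (reindex_inj (h := fun p : 'I_n * 'I_n => (p.2, p.1))) /=; last first.
  by move=> [a b] [c d] [-> ->].
rewrite (eq_bigl (fun p : 'I_n * 'I_n => ~~ fingraph.connect (adj E) p.1 p.2)).
  by rewrite half; ring.
by move=> p; rewrite connect_adj_sym.
Qed.

(** Generalized Cayley formula: a forest with components of sizes s_1, ..., s_k
    lies in n^(k-2) s_1 ... s_k spanning trees. By induction on k: each tree
    containing F arises from F by adding one of its k - 1 remaining edges, and
    merging the components of x and y multiplies the product of the sizes by
    1 / s(x) + 1 / s(y), whose sum over crossing pairs is 2 n (k - 1). The
    formula is multiplied by n to stay in the natural numbers when k = 1. *)
Lemma card_trees_containing (n : nat) (F : {set {set 'I_n}}) : (0 < n)%N ->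
  is_forest F ->
  (n * #|trees_containing F|
   = n ^ (#|components F|).-1 * \prod_(B in components F) #|B|)%N.
Proof.
move=> n0.
have k0 E : (0 < #|components (n := n) E|)%N.
  by apply/card_gt0P; exists (component E (Ordinal n0)); exact: mem_components.
move: {2 3}(_.-1) (erefl (#|components F|).-1) => m.
elim: m F => [|m IH] F km fF.
  have k1 : #|components F| = 1%N by have := k0 F; lia.
  have -> : trees_containing F = [set F].
    apply/setP=> T; rewrite inE in_set1; apply/andP/eqP => [[]|->].
      move=> /(spanning_treesP _ n0)[fT cT] sFT.
      apply/eqP; rewrite eq_sym eqEcard sFT.
      have := card_components_forest fT; have := card_components_forest fF.
      by rewrite k1 cT; lia.
    by split=> //; apply/(spanning_treesP _ n0).
  rewrite cards1 muln1 mul1n; move/eqP: (k1) => /cards1P[B eB].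
  rewrite eB big_set1 -[LHS](card_ord n) -cardsT.
  by rewrite (card_partition (components_partition F)) eB big_set1.
have kF : #|components F| = m.+2 by have := k0 F; lia.
apply/eqP; rewrite -(eqr_nat rat); apply/eqP.
have S : (2 * m.+1)%:R * (n%:R * #|trees_containing F|%:R) =
    \sum_(p : 'I_n * 'I_n | ~~ fingraph.connect (adj F) p.1 p.2)
     (n ^ m)%:R * (\prod_(B in components F) #|B|)%:R *
     (#|component F p.1|%:R^-1 + #|component F p.2|%:R^-1) :> rat.
  rewrite mulrCA -[m.+1]/(m.+2.-1) -kF -[X in _ * X]natrM -sum_trees_setU1 //.
  rewrite natr_sum mulr_sumr; apply: eq_bigr => -[x y] /= ncxy.
  have kE : (#|components ([set x; y] |: F)|).-1 = m.
    by move: (card_components_setU1 ncxy); rewrite kF => -[<-].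
  rewrite -[LHS]natrM IH //; last exact: forest_setU1.
  rewrite natrM -mulrA; congr (_ * _).
  have := prod_components_setU1 ncxy => /(congr1 (fun k => k%:R : rat)).
  rewrite !natrM natrD.
  have s0 z : #|component F z|%:R != 0 :> rat.
    rewrite pnatr_eq0 -lt0n; apply/card_gt0P; exists z; exact: mem_component.
  move=> e; apply: (mulfI (s0 x)); apply: (mulfI (s0 y)).
  rewrite mulrA (mulrC #|component F y|%:R) e; field.
  by rewrite !s0.
move: S; rewrite -mulr_sumr sum_inv_crossing_pairs kF => S.
have m0 : (2 * m.+1)%:R != 0 :> rat by rewrite pnatr_eq0.
apply: (mulfI m0); rewrite [X in _ * X = _]natrM S.
by rewrite expnS !natrM -[m.+2]addn1 natrD; ring.
Qed.

(** Cayley's formula, the case of the edgeless forest. *)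
Lemma card_spanning_trees (n : nat) : (0 < n)%N ->
  (n * #|spanning_trees n| = n ^ n.-1)%N.
Proof.
move=> n0; have f0 : is_forest (set0 : {set {set 'I_n}}).
  by split=> [e|x y]; rewrite /adj inE ?andbF.
have := card_trees_containing n0 f0.
rewrite card_components_set0 [X in _ = (_ * X)%N]big1 ?muln1.
  move=> <-; congr (_ * _)%N; apply: eq_card => T.
  by rewrite [in RHS]inE sub0set andbT.
move=> B /imsetP[x _ ->]; apply/eqP/cards1P; exists x.
apply/setP=> y; rewrite in_set1 -[LHS]/(y \in component set0 x) inE.
apply/idP/eqP => [|->]; last exact: connect0.
by case/connectP=> [[|z p]] //=; rewrite /adj inE andbF.
Qed.

(** * The covering bound *)

Lemma prod_components_le_AGM (R : realFieldType) (n : nat)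
    (E : {set {set 'I_n}}) :
  (\prod_(B in components E) #|B|)%:R
    <= (n%:R / #|components E|%:R) ^+ #|components E| :> R.
Proof.
rewrite natr_prod -[X in X%:R / _](sum_card_components E) natr_sum.
by apply: (leif_AGM _).1 => B _; rewrite ler0n.
Qed.

(** Here s <= 2^(s-1) for each component size s, and the s - 1 add up to the
    number n - k of edges. *)
Lemma prod_components_le_exp2 (n : nat) (E : {set {set 'I_n}}) :
  (\prod_(B in components E) #|B| <= 2 ^ (n - #|components E|))%N.
Proof.
have B1 B : B \in components E -> (0 < #|B|)%N.
  by case/imsetP=> x _ ->; apply/card_gt0P; exists x; exact: mem_component.
have -> : (n - #|components E| = \sum_(B in components E) #|B|.-1)%N.
  rewrite -[X in (X - _)%N](sum_card_components E) -sum1_card -sumnB //.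
  by apply: eq_bigr => B _; rewrite subn1.
rewrite expn_sum; apply: leq_prod => B /B1.
by case: #|B| => // b _; exact: ltn_expl.
Qed.

Lemma leq_card_bigcup (I T : finType) (P : pred I) (F : I -> {set T}) :
  (#|\bigcup_(i | P i) F i| <= \sum_(i | P i) #|F i|)%N.
Proof.
elim/big_ind2: _ => [|A a B b Aa Bb|//]; first by rewrite cards0.
by rewrite (leq_trans (leq_card_setU a b)) // leq_add.
Qed.

(** A largest code cannot be enlarged, so every tree is at distance less than d
    from some codeword, that is, shares at least n - d edges with it. *)
Lemma A_cover (n d : nat) : (0 < d <= n)%N ->
  exists2 C : {set {set {set 'I_n}}},
    C \subset spanning_trees n /\ #|C| = A n d &
    forall T, T \in spanning_trees n ->
      exists2 c, c \in C & (n - d <= #|T :&: c|)%N.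
Proof.
move=> /andP[d0 dn].
have code0 : tree_code d (set0 : {set {set {set 'I_n}}}).
  rewrite /tree_code sub0set; apply/forall_inP => T; by rewrite inE.
have ne : (0 < #|[pred C : {set {set {set 'I_n}}} | tree_code d C]|)%N.
  by apply/card_gt0P; exists set0.
have [C codeC AC] := eq_bigmax_cond (fun C : {set {set {set 'I_n}}} => #|C|) ne.
have {}AC : #|C| = A n d by [].
have /andP[sCS /forall_inP distC] : tree_code d C by [].
exists C => // T ST.
have [TC|nTC] := boolP (T \in C).
  exists T => //; rewrite setIid.
  have n0 : (0 < n)%N by exact: leq_trans dn.
  have [fT cT] := (spanning_treesP T n0).1 ST.
  have := card_components_forest fT; rewrite cT; lia.
have [far|] := boolP [forall c in C, (d <= tree_dist T c)%N]; last first.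
  rewrite negb_forall_in => /exists_inP[c cC].
  rewrite -ltnNge /tree_dist => dTc.
  exists c => //; lia.
have : tree_code d (T |: C).
  apply/andP; split; first by rewrite subUset sub1set ST.
  have dist_sym T1 T2 : tree_dist T1 T2 = tree_dist T2 T1 :> nat.
    by rewrite /tree_dist setIC.
  apply/forall_inP=> T1; rewrite in_setU1 => T1C.
  apply/forall_inP=> T2; rewrite in_setU1 => T2C; apply/implyP => T12.
  case/orP: T1C => [/eqP eT1|T1C]; case/orP: T2C => [/eqP eT2|T2C].
  - by rewrite eT1 eT2 eqxx in T12.
  - by rewrite eT1; exact: (forall_inP far).
  - by rewrite eT2 dist_sym; exact: (forall_inP far).
  - exact: (implyP (forall_inP (distC _ T1C) _ T2C)).
move=> codeTC; have := leq_bigmax_cond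
  (P := fun C : {set {set {set 'I_n}}} => tree_code d C)
  (F := fun C : {set {set {set 'I_n}}} => #|C|) (T |: C) codeTC.
by rewrite -[X in (_ <= X)%N]/(A n d) -AC cardsU1 nTC ltnn.
Qed.

(** By [A_cover], every spanning tree contains a set of n - d edges of some
    codeword. A codeword has 'C(n-1, n-d) such subsets, all forests with d
    components, each lying in at most n^(d-2) M spanning trees. Comparison with
    the total number n^(n-2) gives the bound. *)
Lemma gilbert_varshamov (R : realFieldType) (n d : nat) (M : R) :
  (0 < d <= n)%N -> 0 <= M ->
  (forall F : {set {set 'I_n}}, is_forest F -> #|components F| = d ->
     (\prod_(B in components F) #|B|)%:R <= M) ->
  n%:R ^+ (n - d) <= (A n d)%:R * ('C(n.-1, n - d))%:R * M.
Proof.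
move=> dn M0 HM; have [C [sCS cC] cover] := A_cover dn.
have /andP[d0 ledn] := dn; have n0 : (0 < n)%N by exact: leq_trans ledn.
pose subs (c : {set {set 'I_n}}) :=
  [set F : {set {set 'I_n}} | F \subset c & #|F| == (n - d)%N].
have sub : spanning_trees n \subset
    \bigcup_(c in C) \bigcup_(F in subs c) trees_containing F.
  apply/subsetP=> T ST; have [c Cc le] := cover T ST.
  have [F sF cF] : exists2 F : {set {set 'I_n}},
      F \subset T :&: c & #|F| = (n - d)%N.
    have /card_geqP[s [us <- sTc]] := le.
    exists [set e in s]; last by rewrite cardsE; exact/card_uniqP.
    by apply/subsetP=> e; rewrite inE => /sTc.
  apply/bigcupP; exists c => //; apply/bigcupP; exists F.
    by rewrite inE (subset_trans sF (subsetIr _ _)) cF eqxx.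
  by rewrite inE ST (subset_trans sF (subsetIl _ _)).
have h : (n * #|spanning_trees n|)%:R <=
    \sum_(c in C) \sum_(F in subs c) n%:R ^+ d.-1 * M :> R.
  rewrite natrM; apply: le_trans (_ : n%:R *
    (\sum_(c in C) \sum_(F in subs c) #|trees_containing F|)%:R <= _).
    rewrite ler_wpM2l // ler_nat (leq_trans (subset_leq_card sub)) //.
    apply: (leq_trans (leq_card_bigcup _ _)); apply: leq_sum => c _.
    exact: leq_card_bigcup.
  rewrite natr_sum mulr_sumr; apply: ler_sum => c Cc.
  rewrite natr_sum mulr_sumr; apply: ler_sum => F.
  rewrite inE => /andP[sFc /eqP cF].
  have [fc _] := (spanning_treesP c n0).1 (subsetP sCS _ Cc).
  have fF := forest_subset sFc fc.
  have kF : #|components F| = d by have := card_components_forest fF; lia.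
  rewrite -natrM card_trees_containing // kF natrM natrX.
  by rewrite ler_wpM2l ?HM // exprn_ge0.
rewrite card_spanning_trees // natrX in h.
have e : (n.-1 = d.-1 + (n - d))%N by lia.
rewrite {1}e exprD in h.
have np : 0 < n%:R ^+ d.-1 :> R by rewrite exprn_gt0 // ltr0n.
rewrite -(ler_pM2l np); apply: le_trans h _.
rewrite (eq_bigr (fun _ => ('C(n.-1, n - d))%:R * (n%:R ^+ d.-1 * M))).
  rewrite sumr_const cC -[X in X <= _]mulr_natl le_eqVlt.
  by apply/orP; left; apply/eqP; ring.
move=> c Cc; have [fc kc] := (spanning_treesP c n0).1 (subsetP sCS _ Cc).
rewrite sumr_const -[LHS]mulr_natl; congr (_%:R * _).
have -> : n.-1 = #|c| by have := card_components_forest fc; lia.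
rewrite -cards_draws; apply: eq_card => F; by rewrite !inE.
Qed.

Lemma A_ge_AGM (R : realFieldType) (n d : nat) : (0 < d <= n)%N ->
  n%:R ^+ (n - d)
    <= (A n d)%:R * 'C(n.-1, n - d)%:R * (n%:R / d%:R) ^+ d :> R.
Proof.
move=> dn; apply: gilbert_varshamov => // [|F _ <-].
  by rewrite exprn_ge0 ?divr_ge0.
exact: prod_components_le_AGM.
Qed.

Lemma A_ge_exp2 (R : realFieldType) (n d : nat) : (0 < d <= n)%N ->
  n%:R ^+ (n - d) <= (A n d)%:R * ('C(n.-1, n - d))%:R * 2 ^+ (n - d) :> R.
Proof.
move=> dn; apply: gilbert_varshamov => // [|F _ <-].
  by rewrite exprn_ge0.
by rewrite -natrX ler_nat prod_components_le_exp2.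
Qed.

Lemma A_gt0 (n d : nat) : (0 < d <= n)%N -> (0 < A n d)%N.
Proof.
move=> /[dup] dn0 /andP[d0 dn]; have n0 : (0 < n)%N by exact: leq_trans dn.
rewrite -(ltr0n rat) lt0r ler0n andbT; apply/eqP => A0.
have := A_ge_exp2 rat dn0; rewrite A0 !mul0r leNgt exprn_gt0 // ltr0n //.
Qed.

From mathcomp Require Import all_classical all_reals all_analysis.
Import numFieldNormedType.Exports.
Local Open Scope classical_set_scope.


(** * Logarithms, factorials and binomial coefficients *)

(** The left-hand side is one term of the binomial expansion of (1 + k/n)^n,
    which is at most e^k. *)
Lemma bin_le_exp (R : realType) (n k : nat) : (0 < n)%N ->
  'C(n, k)%:R * (k%:R / n%:R) ^+ k <= expR k%:R :> R.
Proof.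
move=> n0; have [nk|kn] := ltnP n k.
  by rewrite bin_small // mul0r expR_ge0.
apply: (@le_trans _ _ ((1 + k%:R / n%:R) ^+ n)).
  rewrite exprDn (bigD1 (Ordinal (kn : (k < n.+1)%N))) //=.
  rewrite expr1n mul1r mulr_natl lerDl; apply: sumr_ge0 => i _.
  by rewrite mulrn_wge0 // mulr_ge0 ?expr1n // exprn_ge0 // divr_ge0.
have -> : expR k%:R = expR (k%:R / n%:R) ^+ n :> R.
  by rewrite -expRM_natl mulrC divfK // pnatr_eq0 -lt0n.
by rewrite lerXn2r ?nnegrE ?expR_ge0 ?expR_ge1Dx // addr_ge0 // divr_ge0.
Qed.

Lemma leq_bin_pred (n k : nat) : (0 < n)%N -> ('C(n.-1, k) <= 'C(n, k))%N.
Proof. by case: n k => // n [|k] _; rewrite ?bin0 // binS leq_addr. Qed.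

Lemma ln_le_subr1 (R : realType) (t : R) : 0 < t -> ln t <= t - 1.
Proof.
by move=> t0; have := @le_ln1Dx R (t - 1); rewrite addrCA subrr addr0; apply; lra.
Qed.

Lemma ln_ge_1subV (R : realType) (t : R) : 0 < t -> 1 - t^-1 <= ln t.
Proof.
move=> t0; have := @ln_le_subr1 R t^-1; rewrite invr_gt0 t0 lnV ?posrE //.
by move=> /(_ isT); lra.
Qed.

Lemma le_of_derive_ge0 (R : realType) (f df : R -> R) (a b : R) : a <= b ->
  (forall x, a <= x <= b -> is_derive x 1 f (df x)) ->
  (forall x, a <= x <= b -> 0 <= df x) -> f a <= f b.
Proof.
move=> ab Df df0.
have Dab x : x \in `]a, b[%R -> is_derive x 1 f (df x).
  by rewrite in_itv /= => /andP[ax xb]; apply: Df; rewrite !ltW.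
have Cab : {within `[a, b], continuous f}.
  apply: derivable_within_continuous => x; rewrite in_itv /= => xab.
  by have [] := Df x xab.
have [c cab fba] := MVT_segment ab Dab Cab.
rewrite in_itv /= in cab.
by rewrite -subr_ge0 fba mulr_ge0 ?df0 // subr_ge0.
Qed.

(** Both sides vanish at 1, and the difference of the derivatives is
    ln t - (1 - 1/t). *)
Lemma ln_ge_pade (R : realType) (t : R) :
  1 <= t -> 2 * (t - 1) <= (t + 1) * ln t.
Proof.
move=> t1; rewrite -subr_ge0.
have := @le_of_derive_ge0 R (fun x => (x + 1) * ln x - 2 * (x - 1))
  (fun x => ln x - (1 - x^-1)) 1 t t1.
rewrite ln1 subrr !mulr0 subr0; apply.
- move=> x /andP[x1 _].
  have x0 : 0 < x by lra.
  have Dln := is_derive1_ln x0.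
  apply: is_derive_eq.
  by rewrite /GRing.scale /=; field; rewrite gt_eqF.
move=> x /andP[x1 _]; rewrite subr_ge0 ln_ge_1subV //; lra.
Qed.

(** Both sides vanish at 1, and the difference of the derivatives is
    2 (t - 1 - ln t). *)
Lemma ln_le_half_sub_inv (R : realType) (t : R) :
  1 <= t -> 2 * t * ln t <= t ^+ 2 - 1.
Proof.
move=> t1; rewrite -subr_ge0.
have := @le_of_derive_ge0 R (fun x => x ^+ 2 - 1 - 2 * x * ln x)
  (fun x => 2 * (x - 1 - ln x)) 1 t t1.
rewrite ln1 mulr0 subr0 expr1n subrr; apply.
- move=> x /andP[x1 _].
  have x0 : 0 < x by lra.
  have Dln := is_derive1_ln x0.
  apply: is_derive_eq.
  by rewrite /GRing.scale /=; field; rewrite gt_eqF.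
move=> x /andP[x1 _]; rewrite mulr_ge0 // subr_ge0 ln_le_subr1 //; lra.
Qed.

(** The two preceding bounds at t = 1 + 1/n; the upper bound telescopes, since
    1 / (4 n (n + 1)) = 1 / (4 n) - 1 / (4 (n + 1)). *)
Lemma ln_succ_bounds (R : realType) (n : nat) : (0 < n)%N ->
  1 <= (n%:R + 1 / 2 : R) * (ln n.+1%:R - ln n%:R)
    <= 1 + (1 / (4 * n%:R) - 1 / (4 * n.+1%:R)).
Proof.
move=> n0.
have N0 : 0 < n%:R :> R by rewrite ltr0n.
have eS : n.+1%:R = n%:R + 1 :> R by rewrite -natr1.
rewrite -ln_div ?posrE ?ltr0n // eS.
set N := n%:R in N0 eS *.
pose t := (N + 1) / N.
have t1 : 1 <= t by rewrite /t ler_pdivlMr //; lra.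
have := ln_ge_pade t1; have := ln_le_half_sub_inv t1.
have tN : t = 1 + N^-1 by rewrite /t; field; rewrite gt_eqF.
rewrite -/t; set l := ln t => h1 h2.
apply/andP; split.
  rewrite -(ler_pM2l (_ : 0 < 2 / N)); last by rewrite divr_gt0.
  rewrite (_ : _ * (_ * l) = (t + 1) * l); last first.
    by rewrite tN; field; rewrite gt_eqF.
  rewrite (_ : 2 / N * 1 = 2 * (t - 1)) //; by rewrite tN; field; rewrite gt_eqF.
have N1 : 0 < N + 1 by lra.
rewrite -(ler_pM2l (_ : 0 < 2 * t / (N + 1/2))); last first.
  rewrite divr_gt0 //; last lra. rewrite mulr_gt0 //; lra.
rewrite [X in X <= _](_ : _ = 2 * t * l); last first.
  by field; rewrite gt_eqF //; lra.
apply: le_trans h1 _; rewrite le_eqVlt; apply/orP; left; apply/eqP.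
by rewrite /t; field; rewrite !gt_eqF //; lra.
Qed.

(** ln n! - (n + 1/2) ln n + n is nonincreasing and equals 1 at n = 1. *)
Lemma ln_fact_le (R : realType) (n : nat) : (0 < n)%N ->
  ln n`!%:R <= 1 + (n%:R + 1 / 2) * ln n%:R - n%:R :> R.
Proof.
elim: n => // -[_ _|n IH _]; first by rewrite ln1 mulr0; lra.
have := IH isT; have /andP[h _] := @ln_succ_bounds R n.+1 isT.
rewrite [n.+2`!]factS natrM lnM ?posrE ?ltr0n ?fact_gt0 //.
have e : n.+2%:R = n.+1%:R + 1 :> R by rewrite -natr1.
move: (ln n.+2%:R) h => b; rewrite e; lra.
Qed.

(** ln n! - (n + 1/2) ln n + n - 1 / (4 n) is nondecreasing and equals 3/4 at
    n = 1. *)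
Lemma ln_fact_ge (R : realType) (n : nat) : (0 < n)%N ->
  3 / 4 + (n%:R + 1 / 2) * ln n%:R - n%:R <= ln n`!%:R :> R.
Proof.
move=> n0.
suff : 3 / 4 + 1 / (4 * n%:R) + (n%:R + 1 / 2) * ln n%:R - n%:R
    <= ln n`!%:R :> R.
  have : 0 <= 1 / (4 * n%:R) :> R by rewrite divr_ge0 // mulr_ge0.
  lra.
elim: n n0 => // -[_ _|n IH _]; first by rewrite ln1 mulr0; lra.
have := IH isT; have /andP[_ h] := @ln_succ_bounds R n.+1 isT.
rewrite [n.+2`!]factS natrM lnM ?posrE ?ltr0n ?fact_gt0 //.
move: (1 / (4 * n.+1%:R)) (1 / (4 * n.+2%:R)) h => u v.
have e : n.+2%:R = n.+1%:R + 1 :> R by rewrite -natr1.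
move: (ln n.+2%:R) => b; rewrite e; lra.
Qed.

(** The constant is 1 - 2 * (3/4), from one upper and two lower bounds for
    factorials. The sharp constant is - ln (2 pi) / 2, about - 0.92, but - 1/2
    suffices for [A_ge_linear_d]. *)
Lemma ln_bin_le (R : realType) (n d : nat) : (0 < d < n)%N ->
  ln 'C(n, d)%:R <= - (1 / 2) + (n%:R + 1 / 2) * ln n%:R
    - (d%:R + 1 / 2) * ln d%:R - ((n - d)%:R + 1 / 2) * ln (n - d)%:R :> R.
Proof.
move=> /andP[d0 dn].
have n0 : (0 < n)%N by exact: leq_trans dn.
have m0 : (0 < n - d)%N by rewrite subn_gt0.
have := @bin_fact n d (ltnW dn) => /(congr1 (fun k => ln (k%:R : R))).
rewrite !natrM !lnM ?posrE ?mulr_gt0 ?ltr0n ?fact_gt0 ?bin_gt0 // 1?ltnW //.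
have := @ln_fact_le R n n0; have := @ln_fact_ge R d d0.
have := @ln_fact_ge R (n - d) m0.
rewrite (natrB _ (ltnW dn)); lra.
Qed.

(** * The constant c *)

(** The logarithm of x^(x/(1-x)) is - ln y / (y - 1) for y = 1/x, a slope of the
    concave function ln. The proof uses only ln y <= y - 1 and
    ln (y/x) <= y/x - 1. *)
Lemma powR_frac_le (R : realType) (x y : R) : 0 < x -> x <= y -> y < 1 ->
  y `^ (y / (1 - y)) <= x `^ (x / (1 - x)).
Proof.
move=> x0 xy y1; have y0 : 0 < y by lra.
have px : 0 < x `^ (x / (1 - x)) by rewrite powR_gt0.
have py : 0 < y `^ (y / (1 - y)) by rewrite powR_gt0.
rewrite -ler_ln ?posrE // !ln_powR mulrAC [X in _ <= X]mulrAC.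
have ly : ln y <= y - 1 by exact: ln_le_subr1.
have q0 : 0 < y / x by rewrite divr_gt0.
have lyx := ln_le_subr1 q0; rewrite ln_div ?posrE // in lyx.
have {lyx}lyx : x * (ln y - ln x) <= y - x.
  have -> : y - x = x * (y / x - 1) by field; rewrite gt_eqF.
  by rewrite ler_pM2l.
have x1' : 0 < 1 - x by lra. have y1' : 0 < 1 - y by lra.
rewrite ler_pdivrMr // [X in _ <= X]mulrAC ler_pdivlMr //.
have h1 : 0 <= (y - x) * ((y - 1) - ln y) by rewrite mulr_ge0; lra.
have h2 : 0 <= (1 - y) * ((y - x) - x * (ln y - ln x)) by rewrite mulr_ge0; lra.
lra.
Qed.

Lemma powR_frac_le1 (R : realType) (x : R) : 0 < x < 1 ->
  x `^ (x / (1 - x)) <= 1.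
Proof.
move=> /andP[x0 x1]; rewrite -[X in _ <= X](powRr0 x).
by apply: ger_powR; rewrite ?x0 ?(ltW x1) // divr_ge0 // ?subr_ge0 ltW.
Qed.

Lemma c_gt0 (R : realType) (x : R) : 0 < x < 1 -> 0 < c_ x.
Proof.
move=> /andP[x0 x1]; rewrite /c_.
have p0 : 0 < x `^ (x / (1 - x)) by rewrite powR_gt0.
by rewrite !mulr_gt0 ?lt_max ?p0 //; lra.
Qed.

Lemma c_lt1 (R : realType) (x : R) : 0 < x < 1 -> c_ x < 1.
Proof.
move=> /[dup] x01 /andP[x0 x1]; rewrite /c_.
have p0 : 0 < x `^ (x / (1 - x)) by rewrite powR_gt0.
have p1 := powR_frac_le1 x01.
have m1 : Num.max (x `^ (x / (1 - x))) (1 / 2) <= 1 by rewrite ge_max p1 /=; lra.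
apply: (@le_lt_trans _ _ ((1 - x) * 1 * 1)); last lra.
have m0 : 0 < Num.max (x `^ (x / (1 - x))) (1 / 2) by rewrite lt_max p0.
apply: ler_pM => //; rewrite ?mulr_ge0 ?(ltW m0) ?(ltW p0) //; try lra.
by rewrite ler_pM2l //; lra.
Qed.

Lemma c_decreasing (R : realType) (x y : R) : 0 < x -> x < y -> y < 1 ->
  c_ y < c_ x.
Proof.
move=> x0 xy y1; have y0 : 0 < y by lra.
have py : 0 < y `^ (y / (1 - y)) by rewrite powR_gt0.
have := powR_frac_le x0 (ltW xy) y1; rewrite /c_.
set p := y `^ _ in py *; set q := x `^ _ => pq.
have mp0 : 0 < Num.max p (1 / 2) by rewrite lt_max py.
have mpq : Num.max p (1 / 2) <= Num.max q (1 / 2).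
  by rewrite ge_max !le_max pq lexx orbT.
apply: (@lt_le_trans _ _ ((1 - x) * p * Num.max p (1 / 2))).
  by rewrite !ltr_pM2r //; lra.
apply: ler_pM => //; rewrite ?mulr_ge0 ?(ltW mp0) ?(ltW py) //; try lra.
by rewrite ler_pM2l //; lra.
Qed.

(** With s = sqrt x, ln s >= 1 - 1/s bounds x ln x below by - 2 s, hence
    x^(x/(1-x)) >= 1 - 4 s; both this power and the maximum in c are bounded
    below by 1 - 4 s. *)
Lemma c_ge (R : realType) (x : R) : 0 < x -> x <= 1 / 16 ->
  1 - 9 * Num.sqrt x <= c_ x.
Proof.
move=> x0 x16; set s := Num.sqrt x.
have s0 : 0 < s by rewrite sqrtr_gt0.
have ss : s ^+ 2 = x by rewrite sqr_sqrtr // ltW.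
have s4 : s <= 1 / 4.
  rewrite -(ler_pXn2r (n := 2)) ?nnegrE ?(ltW s0) ?ss //; lra.
have p_ge : 1 - 4 * s <= x `^ (x / (1 - x)).
  apply: le_trans (_ : 1 + (x / (1 - x)) * ln x <= _); last first.
    by rewrite /powR gt_eqF // expR_ge1Dx.
  rewrite lerD2l.
  have lnx : - 2 <= s * ln x.
    rewrite -ss lnXn // -mulr_natl.
    have := ln_ge_1subV s0.
    rewrite -(ler_pM2l s0) mulrBr mulr1 divff ?gt_eqF //; lra.
  have x1 : 0 < 1 - x by lra.
  rewrite mulrAC ler_pdivlMr //.
  have h := ler_wpM2l (ltW s0) lnx.
  have h' : 0 <= s * (1 - 2 * x) by apply: mulr_ge0; lra.
  have -> : x * ln x = s * (s * ln x) by rewrite mulrA -expr2 ss.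
  by apply: le_trans h; lra.
rewrite /c_.
set p := x `^ _ in p_ge *.
have m_ge : 1 - 4 * s <= Num.max p (1 / 2) by rewrite le_max p_ge.
have a0 : 0 <= 1 - 4 * s by lra.
have h1 : (1 - x) * (1 - 4 * s) <= (1 - x) * p by rewrite ler_wpM2l //; lra.
have h2 : (1 - x) * (1 - 4 * s) * (1 - 4 * s) <= (1 - x) * p * Num.max p (1 / 2).
  by apply: ler_pM => //; rewrite mulr_ge0 //; lra.
apply: le_trans h2.
rewrite -ss; nra.
Qed.

Lemma c_cvg1 (R : realType) : c_ delta @[delta --> (0 : R)^'+] --> (1 : R).
Proof.
apply/cvgrPdist_le => e e0.
near=> x.
have x0 : 0 < x by [].
have x16 : x <= 1 / 16 by near: x; apply: nbhs_right_le; lra.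
have xe : x <= (e / 9) ^+ 2.
  by near: x; apply: nbhs_right_le; rewrite exprn_gt0 // divr_gt0.
have c1 : c_ x < 1 by apply: c_lt1; rewrite x0; lra.
have cge := c_ge x0 x16.
have se : Num.sqrt x <= e / 9.
  have e90 : 0 <= e / 9 by rewrite divr_ge0 // ltW.
  by rewrite -(ler_pXn2r (n := 2)) ?nnegrE ?sqrtr_ge0 ?sqr_sqrtr // ltW.
rewrite ger0_norm; lra.
Unshelve. all: by end_near.
Qed.

(** * Explicit lower bounds on A *)

(** The product of the component sizes is bounded by (n/d)^d, and the binomial
    coefficient by (e n/d)^d. *)
Lemma A_ge_small_d (R : realType) (n d : nat) : (0 < d <= n)%N ->
  n%:R ^+ (n - d) * (d%:R / n%:R) ^+ (2 * d) / expR d%:R <= (A n d)%:R :> R.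
Proof.
move=> /[dup] dn0 /andP[d0 dn]; have n0 : (0 < n)%N by exact: leq_trans dn.
have nR : 0 < n%:R :> R by rewrite ltr0n.
have dR : 0 < d%:R :> R by rewrite ltr0n.
rewrite ler_pdivrMr ?expR_gt0 //.
have bn : ('C(n.-1, n - d))%:R <= 'C(n, d)%:R :> R.
  by rewrite ler_nat -(bin_sub dn) leq_bin_pred.
have := A_ge_AGM R dn0; have := bin_le_exp R d n0.
have q0 : 0 < d%:R / n%:R :> R by rewrite divr_gt0.
have -> : n%:R / d%:R = (d%:R / n%:R)^-1 :> R by rewrite invf_div.
set q := _ / _ in q0 *; rewrite exprVn => hb hA.
rewrite mul2n -addnn exprD mulrA.
have qd : 0 < q ^+ d by rewrite exprn_gt0.
apply: (@le_trans _ _ ((A n d)%:R * 'C(n.-1, n - d)%:R * q ^+ d)).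
  by rewrite ler_pM2r // -ler_pdivlMr.
rewrite -mulrA ler_wpM2l //; apply: le_trans hb.
by rewrite ler_wpM2r // ltW.
Qed.

Lemma A_ge_sqrt_exp (R : realType) (n d : nat) : (0 < d <= n)%N ->
  (d%:R / (Num.sqrt (expR 1) * n%:R)) ^+ (2 * d) * n%:R ^+ (n - d)
    <= (A n d)%:R :> R.
Proof.
move=> dn; apply: le_trans (A_ge_small_d R dn).
have e2d : Num.sqrt (expR 1) ^+ (2 * d) = expR d%:R :> R.
  by rewrite exprM sqr_sqrtr ?expR_ge0 // -expRM_natl mulr1.
rewrite invfM mulrCA exprMn exprVn e2d le_eqVlt; apply/orP; left; apply/eqP.
move: ((d%:R / n%:R) ^+ _) => q; ring.
Qed.

(** The hypothesis says that (d/n)^2 >= 4/n. *)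
Lemma A_ge_four_div_e (R : realType) (n d : nat) : (0 < d <= n)%N ->
  2 * Num.sqrt n%:R <= d%:R :> R ->
  (4 / expR 1) ^+ d * n%:R `^ (n%:R - 2 * d%:R) <= (A n d)%:R :> R.
Proof.
move=> /[dup] dn0 /andP[d0 dn] sqrt_le; apply: le_trans (A_ge_small_d R dn0).
have n0 : 0 < n%:R :> R by rewrite ltr0n; exact: leq_trans dn.
have nn : n%:R != 0 :> R by rewrite gt_eqF.
have -> : n%:R - 2 * d%:R = (n - d)%:R - d%:R :> R by rewrite natrB //; lra.
rewrite powRB ?nn ?implybT // !powR_mulrn ?(ltW n0) //.
rewrite expr_div_n -expRM_natl mulr1.
rewrite [X in X <= _](_ : _ =
  n%:R ^+ (n - d) * (4 / n%:R) ^+ d / expR d%:R); last first.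
  by rewrite expr_div_n; field; rewrite expf_neq0 //= gt_eqF ?expR_gt0.
rewrite exprM ler_pM2r ?invr_gt0 ?expR_gt0 // ler_pM2l ?exprn_gt0 //.
rewrite lerXn2r ?nnegrE ?exprn_ge0 ?divr_ge0 ?(ltW n0) //.
rewrite expr_div_n expr2 invfM mulrA ler_pM2r ?invr_gt0 //.
rewrite ler_pdivlMr //.
have -> : 4 * n%:R = (2 * Num.sqrt n%:R) ^+ 2 :> R.
  by rewrite exprMn sqr_sqrtr ?(ltW n0) //; ring.
by rewrite lerXn2r ?nnegrE ?mulr_ge0 ?sqrtr_ge0.
Qed.

(** Here d/n = n^(-eps) and e = n^(1 / ln n). *)
Lemma A_ge_subpoly (R : realType) (n d : nat) (eps : R) :
  (0 < d <= n)%N -> (1 < n)%N ->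
  d%:R = n%:R `^ (1 - eps) :> R ->
  n%:R `^ (n%:R - d%:R - (2 * eps + (ln n%:R)^-1) * d%:R) <= (A n d)%:R :> R.
Proof.
move=> /[dup] dn0 /andP[d0 dn] n1 d_eps; apply: le_trans (A_ge_small_d R dn0).
have n0 : 0 < n%:R :> R by rewrite ltr0n; exact: leq_trans dn.
have nn : n%:R != 0 :> R by rewrite gt_eqF.
have L0 : 0 < ln n%:R :> R by rewrite ln_gt0 // ltr1n.
have -> : d%:R / n%:R = n%:R `^ (- eps) :> R.
  rewrite d_eps -[X in _ / X](powRr1 (ltW n0)) -powRB ?nn ?implybT //.
  by congr (_ `^ _); ring.
have -> : expR d%:R = n%:R `^ ((ln n%:R)^-1 * d%:R) :> R.
  by rewrite /powR gt_eqF // mulrAC mulVf ?mul1r // gt_eqF.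
rewrite -(powR_mulrn _ (powR_ge0 n%:R (- eps))) -powRrM -(powR_mulrn _ (ltW n0)).
rewrite -powRD ?nn ?implybT // -powRB ?nn ?implybT //.
rewrite natrM natrB // le_eqVlt; apply/orP; left; apply/eqP.
by congr (_ `^ _); ring.
Qed.

Lemma subpoly_correction_littleo (R : realType) (d : nat -> nat)
    (eps : nat -> R) :
  eps @ \oo --> (0 : R) ->
  (fun n => (2 * eps n + (ln n%:R)^-1) * (d n)%:R : R^o) =o_\oo
    (fun n => (d n)%:R : R^o).
Proof.
move=> /cvgrPdist_le eps0; apply/eqoP => e /= e0.
have e4 : 0 < e / 4 by rewrite divr_gt0.
have e2 : 0 < 2 / e by rewrite divr_gt0.
near=> n.
rewrite normrM; apply: ler_wpM2r; first exact: normr_ge0.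
have he : `|0 - eps n| <= e / 4 by near: n; exact: eps0.
have hn : expR (2 / e) <= n%:R by near: n; exact: nbhs_infty_ger.
have n0 : 0 < n%:R :> R by apply: lt_le_trans hn; exact: expR_gt0.
have hl : 2 / e <= ln n%:R by rewrite -[X in X <= _]expRK ler_ln ?posrE ?expR_gt0.
have hli : (ln n%:R)^-1 <= e / 2.
  rewrite -[X in _ <= X]invf_div lef_pV2 ?posrE //; exact: lt_le_trans hl.
have hl0 : 0 <= (ln n%:R)^-1 :> R.
  by rewrite invr_ge0; apply: le_trans hl; exact: ltW.
rewrite sub0r normrN in he.
apply: le_trans (ler_normD _ _) _.
by rewrite normrM (ger0_norm hl0) (ger0_norm (_ : 0 <= 2)) //; lra.
Unshelve. all: by end_near.
Qed.

(** Everything is compared through logarithms, with x = d/n and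
    t = ln (x^(x/(1-x))). The two terms of the maximum in c correspond to the
    two bounds on the product of the component sizes: the logarithm of the
    better one is - (n - d) mu, where mu is the logarithm of the maximum. By
    [ln_bin_le] all terms that grow with n cancel, and it remains to check
    ln (5/2) + (t + mu) / 2 <= (1 - ln x) / 2. It holds as mu <= 0,
    ln x + t = ln x / (1 - x) <= - 1, and 5/2 <= e. *)
Lemma A_ge_linear_d (R : realType) (n d : nat) : (0 < d < n)%N ->
  5 / 2 * (c_ (d%:R / n%:R) * n%:R) `^ (n%:R - d%:R + 1 / 2) <= (A n d)%:R :> R.
Proof.
move=> /andP[d0 dn].
have n0 : (0 < n)%N by exact: leq_trans dn.
have m0 : (0 < n - d)%N by rewrite subn_gt0.
have dn0 : (0 < d <= n)%N by rewrite d0 ltnW.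
have A0 := A_gt0 dn0.
have C0 : (0 < 'C(n.-1, n - d))%N by rewrite bin_gt0; lia.
have hC : (n * 'C(n.-1, n - d) = d * 'C(n, d))%N.
  rewrite -[X in _ = (_ * X)%N]bin_sub; last exact: ltnW.
  rewrite mul_bin_down subKn //; exact: ltnW.
have NR : 0 < n%:R :> R by rewrite ltr0n.
have DR : 0 < d%:R :> R by rewrite ltr0n.
have MR : 0 < (n - d)%:R :> R by rewrite ltr0n.
have eM : (n - d)%:R = n%:R - d%:R :> R by rewrite natrB // ltnW.
have bnd := @ln_bin_le R n d; rewrite d0 dn in bnd; have {}bnd := bnd isT.
have lnC : ln n%:R + ln 'C(n.-1, n - d)%:R = ln d%:R + ln 'C(n, d)%:R :> R.
  rewrite -!lnM ?posrE ?ltr0n // -?natrM ?hC // bin_gt0; exact: ltnW.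
pose t : R := d%:R * (ln d%:R - ln n%:R) / (n - d)%:R.
have tM : t * (n - d)%:R = d%:R * (ln d%:R - ln n%:R).
  by rewrite /t divfK // gt_eqF.
pose x : R := d%:R / n%:R.
have x0 : 0 < x by rewrite divr_gt0.
have lx : ln x = ln d%:R - ln n%:R by rewrite ln_div.
have e1x : 1 - x = (n - d)%:R / n%:R by rewrite eM /x; field; rewrite gt_eqF.
have l1x : ln (1 - x) = ln (n - d)%:R - ln n%:R by rewrite e1x ln_div.
have gap : ln x + t <= -1.
  have -> : ln x + t = (ln x) * (n%:R / (n - d)%:R).
    by rewrite /t -lx eM; field; rewrite -eM gt_eqF.
  have : ln x <= - ((n - d)%:R / n%:R) by rewrite -e1x opprB ln_le_subr1.
  rewrite -(ler_pM2r (_ : 0 < n%:R / (n - d)%:R)) ?divr_gt0 //.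
  move=> /le_trans; apply; rewrite mulNr lerN2 mulrA divfK ?divff ?gt_eqF //.
have x1 : x <= 1 by rewrite ler_pdivrMr // mul1r ler_nat; exact: ltnW.
have t0 : t <= 0.
  rewrite ler_pdivrMr // mul0r -lx; apply: mulr_ge0_le0; first exact: ltW.
  exact: ln_le0.
have lp : ln (x `^ (x / (1 - x))) = t.
  rewrite ln_powR lx e1x /t /x; field; by rewrite !gt_eqF.
have p0 : 0 < x `^ (x / (1 - x)) by rewrite powR_gt0.
have [mu [mu0 lmax hA]] : exists mu, [/\ mu <= 0,
    ln (Num.max (x `^ (x / (1 - x))) (1 / 2)) = mu &
    (n - d)%:R * ln n%:R
      <= ln (A n d)%:R + ln 'C(n.-1, n - d)%:R - (n - d)%:R * mu].
  have AR : 0 < (A n d)%:R :> R by rewrite ltr0n.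
  have CR : 0 < 'C(n.-1, n - d)%:R :> R by rewrite ltr0n.
  have AC0 := mulr_gt0 AR CR.
  have Nm0 : 0 < n%:R ^+ (n - d) :> R by rewrite exprn_gt0.
  case: (ltP (x `^ (x / (1 - x))) (1 / 2)) => [_|_];
    [exists (ln (1 / 2)) | exists t]; split.
  - by apply: ln_le0; lra.
  - by [].
  - have := A_ge_exp2 R dn0.
    have p2 : 0 < 2 ^+ (n - d) :> R by rewrite exprn_gt0.
    move=> h; rewrite -ler_ln ?posrE ?(mulr_gt0 AC0 p2) // in h.
    move: h; rewrite (lnM AC0 p2) (lnM AR CR) !lnXn // mul1r lnV ?posrE //.
    rewrite -[X in X <= _]mulr_natl -[ln 2 *+ _]mulr_natl.
    lra.
  - exact: t0.
  - exact: lp.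
  - have := A_ge_AGM R dn0.
    have q0 : 0 < n%:R / d%:R :> R by rewrite divr_gt0.
    have qd0 : 0 < (n%:R / d%:R) ^+ d :> R by rewrite exprn_gt0.
    move=> h; rewrite -ler_ln ?posrE ?(mulr_gt0 AC0 qd0) // in h.
    move: h; rewrite (lnM AC0 qd0) (lnM AR CR) !lnXn // ln_div //.
    rewrite -[X in X <= _]mulr_natl -[_ *+ d]mulr_natl.
    lra.
have max0 : 0 < Num.max (x `^ (x / (1 - x))) (1 / 2) by rewrite lt_max p0.
have cx0 : 0 < c_ x by rewrite /c_ !mulr_gt0 // e1x divr_gt0.
have cN0 : 0 < c_ x * n%:R by rewrite mulr_gt0.
have lc : ln (c_ x) = ln (n - d)%:R - ln n%:R + t + mu.
  by rewrite /c_ !lnM ?posrE ?mulr_gt0 // ?lmax ?lp ?l1x // e1x divr_gt0.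
have h52 : 0 < 5 / 2 :> R by lra.
have l52 : ln (5 / 2) <= 1 :> R.
  rewrite -[X in _ <= X]expRK ler_ln ?posrE ?expR_gt0 //.
  have -> : expR 1 = expR (6^-1) ^+ 6 :> R by rewrite -expRM_natl divff.
  (* 6 is the least n with (1 + 1/n)^n >= 5/2. *)
  apply: (@le_trans _ _ ((1 + 6^-1) ^+ 6)); first by lra.
  by rewrite lerXn2r ?nnegrE ?expR_ge0 ?expR_ge1Dx //; lra.
have P0 : 0 < (c_ x * n%:R) `^ (n%:R - d%:R + 1 / 2) by rewrite powR_gt0.
rewrite -ler_ln ?posrE ?ltr0n ?(mulr_gt0 h52 P0) //.
rewrite (lnM h52 P0) ln_powR (lnM cx0 NR) lc -eM.
have eN : n%:R = (n - d)%:R + d%:R :> R by rewrite eM subrK.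
rewrite lx in gap.
move: bnd; rewrite {1}eN.
move: hA lnC tM gap t0 mu0 l52.
clear.
move: (ln n%:R) (ln d%:R) (ln (n - d)%:R) (ln (A n d)%:R) (ln (5 / 2)) t.
move: (ln 'C(n.-1, n - d)%:R) (ln 'C(n, d)%:R) => lC lC' lN lD lM lA l5 t.
lra.
Qed.

(** As c is decreasing, rounding d down only strengthens the bound. *)
Lemma A_ge_of_le_delta (R : realType) (n d : nat) (delta : R) :
  (0 < d < n)%N -> delta < 1 -> d%:R <= delta * n%:R ->
  5 / 2 * (c_ delta * n%:R) `^ (n%:R - d%:R + 1 / 2) <= (A n d)%:R :> R.
Proof.
move=> dn delta1 d_le; apply: le_trans (A_ge_linear_d R dn).
have /andP[d0 dltn] := dn.
have n0 : 0 < n%:R :> R by rewrite ltr0n; exact: leq_trans dltn.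
have x0 : 0 < d%:R / n%:R :> R by rewrite divr_gt0 // ltr0n.
have x_le : d%:R / n%:R <= delta by rewrite ler_pdivrMr.
have delta0 : 0 < delta by exact: lt_le_trans x_le.
have c0 : 0 < c_ delta by apply: c_gt0; rewrite delta0.
have cx : c_ delta <= c_ (d%:R / n%:R).
  have [->|ne] := eqVneq (d%:R / n%:R) delta; first exact: lexx.
  by apply: ltW; apply: c_decreasing; rewrite // lt_neqAle ne.
rewrite ler_pM2l; last by rewrite divr_gt0.
have c0n : 0 <= c_ delta * n%:R by rewrite mulr_ge0 ?(ltW c0) ?(ltW n0).
have le_n : c_ delta * n%:R <= c_ (d%:R / n%:R) * n%:R by rewrite ler_pM2r.
apply: ge0_ler_powR => //.
- have : d%:R <= n%:R :> R by rewrite ler_nat ltnW.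
  lra.
- by rewrite nnegrE (le_trans c0n).
Qed.

(** The product of the component sizes is bounded by 2^(n-d), and the binomial
    coefficient by (e n/(n-d))^(n-d). *)
Lemma A_ge_large_d (R : realType) (n d : nat) : (0 < d < n)%N ->
  ((n - d)%:R / (2 * expR 1)) ^+ (n - d) <= (A n d)%:R :> R.
Proof.
move=> /andP[d0 dn]; have n0 : (0 < n)%N by exact: leq_trans dn.
have nR : 0 < n%:R :> R by rewrite ltr0n.
have m0 : 0 < (n - d)%:R :> R by rewrite ltr0n subn_gt0.
have dn0 : (0 < d <= n)%N by rewrite d0 ltnW.
have := A_ge_exp2 R dn0; have := bin_le_exp R (n - d) n0.
have bn : ('C(n.-1, n - d))%:R <= 'C(n, n - d)%:R :> R.
  by rewrite ler_nat leq_bin_pred.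
set m := (n - d)%N in m0 bn *.
rewrite !expr_div_n exprMn -expRM_natl mulr1.
have nm : 0 < n%:R ^+ m :> R by rewrite exprn_gt0.
have t0 : 0 < 2 ^+ m :> R by rewrite exprn_gt0.
rewrite mulrA ler_pdivrMr // => hb hA.
rewrite ler_pdivrMr ?mulr_gt0 ?expR_gt0 //.
have mm0 : 0 <= m%:R ^+ m :> R by rewrite exprn_ge0.
rewrite -(ler_pM2r nm).
apply: (@le_trans _ _ (m%:R ^+ m * ((A n d)%:R * 'C(n.-1, m)%:R * 2 ^+ m))).
  by rewrite ler_wpM2l.
rewrite (_ : _ * (_ * _ * _) =
  (A n d)%:R * 2 ^+ m * ('C(n.-1, m)%:R * m%:R ^+ m)); last by ring.
rewrite [X in _ <= X](_ : _ =
  (A n d)%:R * 2 ^+ m * (expR m%:R * n%:R ^+ m)); last by ring.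
have c0 : 0 <= (A n d)%:R * 2 ^+ m :> R by rewrite mulr_ge0 // ltW.
by rewrite ler_wpM2l //; apply: le_trans hb; rewrite ler_wpM2r.
Qed.

(* nonnegative derivative *)

(** Let L = ln n, y = ln L, m = n - d, h = 1 / (2 (k + 1)). The hypotheses on y
    absorb the rounding error and the constant 2 e: m >= (k + 1/2) L / y and
    m / (2 e) >= e^((1 - h) y). So (m / (2 e))^m is at least the exponential of
    (1 - h) (k + 1/2) L = (k + 1/2)^2 / (k + 1) L >= k L. *)
Lemma pow_le_A (R : realType) (n d k : nat) : (0 < d < n)%N -> (0 < k)%N ->
  let y := ln (ln n%:R) : R in
  2 * y <= expR y -> 4 <= y ->
  2 * expR 1 * y <= expR (y / (2 * k.+1%:R)) ->
  `|d%:R - (n%:R - k.+1%:R * ln n%:R / y)| < 1 ->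
  n%:R ^+ k <= (A n d)%:R :> R.
Proof.
move=> dn k1 y y_exp y4 y_exp2; rewrite ltr_norml => /andP[_ hd].
have /andP[d0 dltn] := dn.
have n0 : 0 < n%:R :> R by rewrite ltr0n; exact: leq_trans dltn.
apply: le_trans (A_ge_large_d R dn).
have L0 : 0 < ln n%:R :> R.
  rewrite ltNge; apply/negP => L0; move: y4; rewrite /y ln0 //; lra.
have eL : expR y = ln n%:R by rewrite lnK.
rewrite -eL in hd y_exp.
set m := (n - d)%N.
have y0 : 0 < y by lra.
have E0 : 0 < expR 1 :> R by exact: expR_gt0.
have K0 : 1 <= k%:R :> R by rewrite ler1n.
have K1 : k.+1%:R = k%:R + 1 :> R by rewrite -natr1.
have q1 : 2 <= expR y / y by rewrite ler_pdivlMr.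
have m_ge : (k%:R + 1 / 2) * (expR y / y) <= m%:R.
  rewrite /m natrB 1?ltnW //; move: hd; rewrite K1 -mulrA; lra.
have base_ge : expR (y * (1 - 1 / (2 * k.+1%:R))) <= m%:R / (2 * expR 1).
  have -> : y * (1 - 1 / (2 * k.+1%:R)) = y - y / (2 * k.+1%:R) by ring.
  rewrite expRB ler_pdivrMr ?expR_gt0 // mulrAC ler_pdivlMr ?mulr_gt0 //.
  apply: (@le_trans _ _ (expR y / y * expR (y / (2 * k.+1%:R)))).
    rewrite -mulrA ler_pM2l ?expR_gt0 // ler_pdivlMl //.
    apply: le_trans y_exp2; rewrite le_eqVlt.
    by apply/orP; left; apply/eqP; ring.
  rewrite ler_wpM2r ?expR_ge0 //; apply: le_trans m_ge.
  have : 0 <= (k%:R - 1) * (expR y / y).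
    by rewrite mulr_ge0 ?subr_ge0 // divr_ge0 ?expR_ge0 ?(ltW y0).
  lra.
have eta0 : 0 <= y * (1 - 1 / (2 * k.+1%:R)).
  rewrite mulr_ge0 ?(ltW y0) // subr_ge0 ler_pdivrMr ?mulr_gt0 //.
  by rewrite K1; lra.
apply: (@le_trans _ _ (expR (y * (1 - 1 / (2 * k.+1%:R))) ^+ m)); last first.
  by rewrite lerXn2r ?nnegrE ?expR_ge0 // divr_ge0 // mulr_ge0 ?expR_ge0.
rewrite -expRM_natl -[X in X ^+ _](lnK (x := n%:R)) // -expRM_natl ler_expR -eL.
apply: le_trans (ler_wpM2r eta0 m_ge).
have -> : (k%:R + 1 / 2) * (expR y / y) * (y * (1 - 1 / (2 * k.+1%:R)))
   = (k%:R + 1 / 2) ^+ 2 / (k%:R + 1) * expR y.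
  by rewrite K1; field; rewrite !gt_eqF //; lra.
rewrite ler_wpM2r ?expR_ge0 // ler_pdivlMr; lra.
Qed.

Lemma A_bigOmega (R : realType) (d : nat -> nat) (k : nat) : (0 < k)%N ->
  (\forall n \near \oo, (0 < d n < n)%N) ->
  (\forall n \near \oo,
     `|(d n)%:R - (n%:R - k.+1%:R * ln n%:R / ln (ln n%:R))| < 1 :> R) ->
  (fun n => (A n (d n))%:R : R^o) \is 'Omega_\oo (fun n => n%:R ^+ k : R^o).
Proof.
move=> k1 dn dk; apply/asboolP; exists 1 => //.
pose K : R := 2 * k.+1%:R.
have K0 : 0 < K by rewrite mulr_gt0.
(* Beyond Y, both 2 y <= y^2 / 2 and 2 e y <= (y / K)^2 / 2, and z^2 / 2 <= e^z. *)
pose Y : R := 4 + 4 * expR 1 * K ^+ 2.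
have Y4 : 4 <= Y by rewrite lerDl mulr_ge0 ?sqr_ge0 // mulr_ge0 ?expR_ge0.
near=> n.
have hn : expR (expR Y) <= n%:R by near: n; exact: nbhs_infty_ger.
have hd : (0 < d n < n)%N by near: n.
have n0 : 0 < n%:R :> R by apply: lt_le_trans hn; exact: expR_gt0.
have hL : expR Y <= ln n%:R by rewrite -[X in X <= _]expRK ler_ln ?posrE ?expR_gt0.
have L0 : 0 < ln n%:R :> R by apply: lt_le_trans hL; exact: expR_gt0.
have hy : Y <= ln (ln n%:R) by rewrite -[X in X <= _]expRK ler_ln ?posrE ?expR_gt0.
rewrite mul1r !ger0_norm ?exprn_ge0 //.
have exp_ge z : 0 <= z -> z ^+ 2 / 2 <= expR z :> R.
  by move=> z0; have := @expR_ge1Dxn R z 1 z0; rewrite (_ : 2`! = 2%N) //; lra.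
apply: pow_le_A => //.
- set y := ln (ln _) in hy *.
  have y0 : 0 <= y by lra.
  apply: le_trans (exp_ge _ y0).
  have : 0 <= y * (y - 4) by rewrite mulr_ge0 //; lra.
  lra.
- lra.
- rewrite -/K; set y := ln (ln _) in hy *.
  have y0 : 0 <= y by lra.
  have yK0 : 0 <= y / K by rewrite divr_ge0 // ltW.
  apply: le_trans (exp_ge _ yK0).
  rewrite expr_div_n ler_pdivlMr // ler_pdivlMr ?exprn_gt0 //.
  have : 0 <= y * (y - 4 * expR 1 * K ^+ 2).
    by rewrite mulr_ge0 //; rewrite /Y in hy; lra.
  lra.
by near: n.
Unshelve. all: by end_near.
Qed.

Theorem mainTheorem4 (R : realType) :
  [/\
  forall d : nat -> nat, admissible d ->
    (fun n => (d n)%:R : R^o) =o_\oo (fun n => n%:R : R^o) ->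
    [/\ \forall n \near \oo,
          ((d n)%:R / (Num.sqrt (expR 1) * n%:R)) ^+ (2 * d n)
            * n%:R ^+ (n - d n) <= (A n (d n))%:R :> R,
        (\forall n \near \oo, 2 * Num.sqrt n%:R <= (d n)%:R :> R) ->
        \forall n \near \oo,
          (4 / expR 1) ^+ d n * n%:R `^ (n%:R - 2 * (d n)%:R)
            <= (A n (d n))%:R :> R
      & forall eps : nat -> R, eps @ \oo --> (0 : R) ->
        (\forall n \near \oo, (d n)%:R = n%:R `^ (1 - eps n)) ->
        exists g : nat -> R,
          (fun n => g n : R^o) =o_\oo (fun n => (d n)%:R : R^o) /\
          \forall n \near \oo,
            n%:R `^ (n%:R - (d n)%:R - g n) <= (A n (d n))%:R],
  [/\ forall delta : R, 0 < delta < 1 ->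
        forall d : nat -> nat, admissible d ->
        (\forall n \near \oo, d n = Num.truncn (delta * n%:R)) ->
        \forall n \near \oo,
          (5 / 2) * (c_ delta * n%:R) `^ (n%:R - (d n)%:R + 1 / 2)
            <= (A n (d n))%:R,
      forall delta : R, 0 < delta < 1 -> 0 < c_ delta < 1,
      forall delta1 delta2 : R,
        0 < delta1 -> delta1 < delta2 -> delta2 < 1 -> c_ delta2 < c_ delta1
    & c_ delta @[delta --> (0 : R)^'+] --> (1 : R)]
  &
  forall d : nat -> nat, admissible d ->
    ((fun n => n%:R - (d n)%:R : R^o) =o_\oo (fun n => n%:R : R^o) ->
     \forall n \near \oo,
       ((n%:R - (d n)%:R) / (2 * expR 1)) ^+ (n - d n)
         <= (A n (d n))%:R :> R)
    /\
    (forall k : nat, (1 <= k)%N ->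
     (\forall n \near \oo,
        `|(d n)%:R - (n%:R - (k.+1)%:R * ln n%:R / ln (ln n%:R))| < 1 :> R) ->
     (fun n => (A n (d n))%:R : R^o) \is 'Omega_\oo (fun n => n%:R ^+ k : R^o))].
Proof.
split.
- move=> d adm _; split.
  + near=> n; apply: A_ge_sqrt_exp.
    by have : (1 < d n <= n - 2)%N; [near: n|lia].
  + move=> d_large; near=> n; apply: A_ge_four_div_e; last by near: n.
    by have : (1 < d n <= n - 2)%N; [near: n|lia].
  + move=> eps eps0 d_eps.
    exists (fun n => (2 * eps n + (ln n%:R)^-1) * (d n)%:R); split.
      exact: subpoly_correction_littleo.
    near=> n.
    have dn : (1 < d n <= n - 2)%N by near: n.
    by apply: A_ge_subpoly; [lia|lia|near: n].
- split; last exact: c_cvg1; last exact: c_decreasing; last first.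
    by move=> delta h; rewrite c_gt0 ?c_lt1.
  move=> delta /andP[delta0 delta1] d adm d_trunc; near=> n.
  have dn : (1 < d n <= n - 2)%N by near: n.
  apply: A_ge_of_le_delta; [lia|by []|].
  have -> : d n = Num.truncn (delta * n%:R) by near: n.
  by rewrite truncn_le // mulr_ge0 // ltW.
- move=> d adm; split=> [_|k k1 d_k].
    near=> n; have dn : (1 < d n <= n - 2)%N by near: n.
    rewrite -natrB; last by lia.
    by apply: A_ge_large_d; lia.
  apply: A_bigOmega => //; near=> n.
  by have : (1 < d n <= n - 2)%N; [near: n|lia].
Unshelve. all: by end_near.
Qed.
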